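(* Let $X$ be a pure $k$-dimensional simplicial complex and $\Delta^{\mathrm{up}}_{k-1}=\Delta^{\mathrm{up}}_{k-1}(X)$. Assume there are reals $\lambda_{\min},\lambda_{\max}$ such that for every $F\in X_{k-2}$, every eigenvalue $\lambda$ of the normalized graph Laplacian $\Delta(\mathrm{lk}\,F)$ other than the smallest one $\lambda_1=0$ (i.e. $\lambda_2,\dots,\lambda_m$, with $m$ the number of vertices of $\mathrm{lk}\,F$) satisfies $\lambda_{\min}\le\lambda\le\lambda_{\max}$. Then for all $f\in C^{k-1}(X;\mathbb R)$ orthogonal to $B^{k-1}(X)$ with respect to $\langle\cdot,\cdot\rangle$, $$(1+k\lambda_{\min}-k)\langle f,f\rangle\le\langle\Delta^{\mathrm{up}}_{k-1}f,f\rangle\le(1+k\lambda_{\max}-k)\langle f,f\rangle.$$ Hence all nontrivial eigenvalues of $\Delta^{\mathrm{up}}_{k-1}$ lie in $[1+k\lambda_{\min}-k,\,1+k\lambda_{\max}-k]$.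
   Context: Complexes have linearly ordered vertex sets; $X_i$ is the set of $i$-faces; $[F:G]$ is the oriented incidence number ($(-1)^j$ if $F\setminus G=\{v_j\}$, $F=\{v_0<\dots<v_i\}$; $0$ if $G\not\subseteq F$). $\deg(F)$ is the number of $k$-faces containing $F$; pure means all maximal faces have dimension $k$. $B^{k-1}(X)=\operatorname{im}\delta_{k-2}\subseteq C^{k-1}(X;\mathbb R)=\mathbb R^{X_{k-1}}$ where $(\delta f)(H)=\sum_G[H:G]f(G)$. $\langle f,g\rangle=\sum_{F\in X_{k-1}}\deg(F)f(F)g(F)$. $A_{k-1}(X)$ has entry $[F:F\cap G][G:F\cap G]$ if $|F\cap G|=k-1$ and $F\cup G\in X_k$, else $0$; $\Delta^{\mathrm{up}}_{k-1}(X)=I-D_{k-1}^{-1}A_{k-1}(X)$, $D_{k-1}$ the diagonal degree matrix; nontrivial eigenvalues are those of its restriction to the $\langle\cdot,\cdot\rangle$-orthogonal complement of $B^{k-1}(X)$. The link $\mathrm{lk}\,F=\{G\in X: F\cup G\in X,\ F\cap G=\emptyset\}$; for $F\in X_{k-2}$ it is a graph (without isolated vertices when $X$ is pure). For a graph $G$ without isolated vertices, $\Delta(G)=I-D^{-1}A$ with $A$ the adjacency matrix and $D$ the diagonal degree matrix. *)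

(* Defs.v *)
(* Vertices are 'I_n, linearly ordered by their nat value.
   Faces are finite sets of vertices; a complex is a set of faces.
   An i-face has cardinality i+1. *)
From HB Require Import structures.
From mathcomp Require Import all_boot all_order all_algebra.
Set Implicit Arguments. Unset Strict Implicit. Unset Printing Implicit Defensive.
Import Order.TTheory GRing.Theory Num.Theory.
Local Open Scope ring_scope.

Section Defs.
Variables (R : rcfType) (n : nat).
Notation V := 'I_n.
Implicit Types (X : {set {set V}}) (F G H : {set V}) (k : nat).

Definition is_complex X : Prop :=
  forall F G, F \in X -> G \subset F -> G \in X.

Definition pure_dim X k : Prop :=
  (forall F, F \in X -> (#|F| <= k.+1)%N) /\
  (forall F, F \in X -> exists2 H, H \in X & (#|H| == k.+1) && (F \subset H)).

(* X_i as the set of faces of cardinality i+1; we index by cardinality *)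
Definition faces_card X c : {set {set V}} := [set F in X | #|F| == c].

Definition incid F G : R :=
  if (G \subset F) && (#|F| == #|G|.+1)%N then
    match [pick v in F :\: G] with
    | Some v => (-1) ^+ #|[set u in F | (val u < val v)%N]|
    | None => 0
    end
  else 0.

Definition deg X k F : nat := #|[set H in X | (#|H| == k.+1) && (F \subset H)]|.

Definition ip X k (f g : {set V} -> R) : R :=
  \sum_(F in faces_card X k) (deg X k F)%:R * f F * g F.

Definition cobound X k (g : {set V} -> R) (H : {set V}) : R :=
  \sum_(G in faces_card X k.-1) incid H G * g G.

Definition orth_B X k (f : {set V} -> R) : Prop :=
  forall g : {set V} -> R, ip X k f (cobound X k g) = 0.

Definition Aup X k F G : R :=
  if (#|F :&: G| == k.-1)%N && (F :|: G \in X) then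
    incid F (F :&: G) * incid G (F :&: G)
  else 0.

Definition Lup X k (f : {set V} -> R) (F : {set V}) : R :=
  f F - ((deg X k F)%:R)^-1 * \sum_(G in faces_card X k) Aup X k F G * f G.

Definition lk_verts X F : {set V} := [set v | (v \notin F) && (v |: F \in X)].
Definition lk_adj X F (u v : V) : bool :=
  [&& u \in lk_verts X F, v \in lk_verts X F, u != v & u |: (v |: F) \in X].
Definition lk_deg X F (u : V) : nat := #|[set w | lk_adj X F u w]|.

Definition lk_laplacian X F : 'M[R]_#|lk_verts X F| :=
  \matrix_(i, j)
    let u := enum_val i in let v := enum_val j in
    (i == j)%:R - (lk_adj X F u v)%:R / (lk_deg X F u)%:R.

End Defs.

(* Main.v *)
(** For a (k-2)-face F put f_F(v) = [F+v : F] f(F+v), a function on the vertices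
    of lk F. Summing over F, the degree-weighted norms of the f_F add up to
    k <f,f>, because a (k-1)-face has k facets, and their adjacency forms add up
    to the form of A_{k-1}, because two (k-1)-faces in a common k-face share
    exactly one facet. Hence
      <Lup f, f> = (1 - k) <f,f> + sum_F <Delta(lk F) f_F, f_F>.
    Orthogonality of f to the coboundary of the indicator of F says that f_F is
    orthogonal to the constants, so each summand is controlled by the
    eigenvalues of Delta(lk F) other than the smallest one. *)
Require Import Defs.
From HB Require Import structures.
From mathcomp Require Import all_boot all_order all_algebra.
From mathcomp Require Import complex ring.
Set Implicit Arguments. Unset Strict Implicit. Unset Printing Implicit Defensive.
Import Order.TTheory GRing.Theory Num.Theory.
Local Open Scope ring_scope.

(** * Rayleigh quotients of symmetric matrices *)

Section Spectral.
Local Open Scope sesquilinear_scope.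

Lemma char_poly_conj (R : comUnitRingType) m (T M : 'M[R]_m) :
  T \in unitmx -> char_poly (T *m M *m invmx T) = char_poly M.
Proof.
move=> Tu; rewrite /char_poly /char_poly_mx !map_mxM.
set P := map_mx polyC T; set Q := map_mx polyC (invmx T).
have PQ : P *m Q = 1%:M by rewrite -map_mxM mulmxV // map_mx1.
have -> : 'X%:M - P *m map_mx polyC M *m Q = P *m ('X%:M - map_mx polyC M) *m Q.
  by rewrite mulmxBr mulmxBl scalar_mxC -(mulmxA _ P) PQ mulmx1.
by rewrite !det_mulmx mulrAC -det_mulmx PQ det1 mul1r.
Qed.

Lemma char_poly_diag_mx (R : comNzRingType) m (d : 'rV[R]_m) :
  char_poly (diag_mx d) = \prod_i ('X - (d 0 i)%:P).
Proof.
rewrite char_poly_trig ?diag_mx_is_trig //.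
by apply: eq_bigr => i _; rewrite mxE eqxx.
Qed.

(** The spectral theorem is applied over the closed field [R[i]], so [P] is complex even though [S]
    is real. Eigenvalues of a hermitian matrix are real, hence [d] lives over [R], and the
    factorization of [char_poly S] descends because [map_poly] along [real_complex R] is
    injective. *)
Lemma symmetric_diagonalization (R : rcfType) m (S : 'M[R]_m) :
  S^T = S ->
  exists (P : 'M[R[i]]_m) (d : 'rV[R]_m),
    [/\ P \is unitarymx,
        map_mx (real_complex R) S
          = P^t* *m diag_mx (map_mx (real_complex R) d) *m P
      & char_poly S = \prod_i ('X - (d 0 i)%:P)].
Proof.
move=> symS; pose SC := map_mx (real_complex R) S.
have hermS : SC \is hermsymmx.
  apply: realsym_hermsym.
    apply/is_hermitianmxP; rewrite expr0 scale1r map_mx_id //.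
    by rewrite map_trmx symS.
  by apply/mxOverP => i j; rewrite mxE; apply/complex_realP; exists (S i j).
have /hermitian_normalmx /orthomx_spectralP eqS := hermS.
have /mxOverP dreal := hermitian_spectral_diag_real hermS.
pose P := spectralmx SC; pose d := map_mx (@complex.Re R) (spectral_diag SC).
have dE : map_mx (real_complex R) d = spectral_diag SC.
  by apply/matrixP => i j; rewrite !mxE RRe_real.
have uP : P \is unitarymx := spectral_unitarymx SC.
exists P, d; split=> //; first by rewrite dE -invmx_unitary.
apply: (@map_poly_inj _ _ (real_complex R)).
rewrite map_char_poly -/SC eqS -dE.
have := @char_poly_conj _ _ (invmx P) (diag_mx (map_mx (real_complex R) d)).
rewrite invmxK unitmx_inv unitarymx_unit // => -> //.
rewrite char_poly_diag_mx rmorph_prod; apply: eq_bigr => i _.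
by rewrite rmorphB /= map_polyX map_polyC /= mxE.
Qed.

(** Vectors are rows, so [x *m P^t*] lists the coordinates of [x] in the orthonormal basis formed by
    the rows of [P]. *)
Lemma unitary_coords_dot (C : numClosedFieldType) m (P : 'M[C]_m)
    (d x w : 'rV[C]_m) :
  (x *m (P^t* *m diag_mx d *m P) *m w^t*) 0 0
    = \sum_i d 0 i * ((x *m P^t*) 0 i * ((w *m P^t*) 0 i)^*).
Proof.
have -> : x *m (P^t* *m diag_mx d *m P) *m w^t*
          = (x *m P^t*) *m diag_mx d *m (w *m P^t*)^t*.
  by rewrite trmx_mul map_mxM trmxCK !mulmxA.
rewrite mul_mx_diag !mxE; apply: eq_bigr => i _.
by rewrite !mxE mulrAC mulrC mulrA.
Qed.

Lemma unitary_dot (C : numClosedFieldType) m (P : 'M[C]_m) (x w : 'rV[C]_m) :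
  P \is unitarymx ->
  (x *m w^t*) 0 0 = \sum_i (x *m P^t*) 0 i * ((w *m P^t*) 0 i)^*.
Proof.
move=> uP.
have -> : x *m w^t* = (x *m P^t*) *m (w *m P^t*)^t*.
  by rewrite trmx_mul map_mxM trmxCK mulmxA mulmxKtV.
by rewrite !mxE; apply: eq_bigr => i _; rewrite !mxE.
Qed.

Lemma real_form_complexE (R : rcfType) m (S : 'M[R]_m) (x w : 'rV[R]_m)
    (toC := real_complex R) :
  toC ((x *m S *m w^T) 0 0) = (map_mx toC x *m map_mx toC S *m (map_mx toC w)^t*) 0 0.
Proof.
rewrite -map_mxM.
have -> : (map_mx toC w)^t* = map_mx toC w^T.
  apply/matrixP => i j; rewrite !mxE conj_Creal //.
  by apply/complex_realP; exists (w j i).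
by rewrite -map_mxM [RHS]mxE.
Qed.

(** Bridges two descriptions of the spectrum: the hypotheses drop the head of a sorted list, while
    diagonalization gives an indexed family. Removing one index that attains the minimum removes one
    copy of the head, so a repeated minimum stays in the tail. *)
Lemma min_spectrum_perm (R : realDomainType) m (d : 'I_m -> R) (i0 : 'I_m)
    (s : seq R) :
  (forall i, d i0 <= d i) -> sorted <=%R s ->
  perm_eq s [seq d i | i <- enum 'I_m] ->
  forall i, i != i0 -> d i \in behead s.
Proof.
move=> dmin; case: s => [|h s] sorted_s perm_s i ii0.
  move: (perm_size perm_s); rewrite size_map size_enum_ord => m0.
  by have := leq_ltn_trans (leq0n i) (ltn_ord i); rewrite -m0.
have h_min : h = d i0.
  have /mapP[j _ hj] : h \in [seq d i | i <- enum 'I_m].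
    by rewrite -(perm_mem perm_s) mem_head.
  have : d i0 \in h :: s by rewrite (perm_mem perm_s) map_f ?mem_enum.
  rewrite inE; case/predU1P => [-> //|in_s]; apply/le_anti.
  by rewrite {2}hj dmin (allP (order_path_min le_trans sorted_s)).
have perm_i0 : perm_eq (enum 'I_m) (i0 :: rem i0 (enum 'I_m)).
  by apply: perm_to_rem; rewrite mem_enum.
have : perm_eq (h :: s) (d i0 :: [seq d i | i <- rem i0 (enum 'I_m)]).
  by rewrite (perm_trans perm_s) // -map_cons perm_map.
rewrite h_min perm_cons => /perm_mem -> /=.
by rewrite map_f // mem_rem_uniq ?enum_uniq // inE ii0 mem_enum.
Qed.

Section SymmetricRayleigh.
Variable R : rcfType.
Local Notation toC := (real_complex R).
Variables (m : nat) (S : 'M[R]_m) (w : 'rV[R]_m) (lmin lmax : R).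
Hypothesis symS : S^T = S.
Hypothesis psdS : forall x : 'rV[R]_m, 0 <= (x *m S *m x^T) 0 0.
Hypotheses (wS0 : w *m S = 0) (w_neq0 : w != 0).
Hypothesis spectrumS : forall s : seq R, sorted <=%R s ->
  char_poly S = \prod_(x <- s) ('X - x%:P) ->
  forall x, x \in behead s -> lmin <= x <= lmax.

Lemma psd_eigenvalue_ge0 a : root (char_poly S) a -> 0 <= a.
Proof.
rewrite -eigenvalue_root_char => /eigenvalueP[v vS v_neq0].
have vv_gt0 : 0 < (v *m v^T) 0 0.
  have [j vj] := rV0Pn _ v_neq0; rewrite mxE (bigD1 j) //= mxE -expr2.
  rewrite ltr_wpDr ?exprn_even_gt0 //.
  by apply: sumr_ge0 => i _; rewrite mxE -expr2 sqr_ge0.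
by have := psdS v; rewrite vS -scalemxAl mxE pmulr_lge0.
Qed.

(** In eigencoordinates both forms are sums with the same weights [q i >= 0], so it suffices to
    bound each [d 0 i] of nonzero weight. The kernel vector [w] singles out an index [i0] with
    eigenvalue 0, which is the smallest one by positivity of [S]. *)
Lemma symmetric_rayleigh (x : 'rV[R]_m) : (x *m w^T) 0 0 = 0 ->
  lmin * (x *m x^T) 0 0 <= (x *m S *m x^T) 0 0 <= lmax * (x *m x^T) 0 0.
Proof.
move=> xw0.
have [P [d [uP eqS charS]]] := symmetric_diagonalization symS.
pose y := map_mx toC x *m P^t*; pose z := map_mx toC w *m P^t*.
pose q i := complex.Re (`|y 0 i| ^+ 2).
have qE i : toC (q i) = y 0 i * (y 0 i)^*.
  by rewrite -normCK; apply: RRe_real; rewrite ger0_real ?exprn_ge0.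
have q_ge0 i : 0 <= q i by rewrite -ler0c qE -normCK exprn_ge0.
have formE : (x *m S *m x^T) 0 0 = \sum_i d 0 i * q i.
  apply: (@complexI R); rewrite real_form_complexE eqS unitary_coords_dot.
  by rewrite rmorph_sum; apply: eq_bigr => i _; rewrite rmorphM /= qE mxE.
have normE : (x *m x^T) 0 0 = \sum_i q i.
  apply: (@complexI R); rewrite -[x in LHS]mulmx1 real_form_complexE map_mx1.
  rewrite !mulmx1 (unitary_dot _ _ uP) rmorph_sum.
  by apply: eq_bigr => i _; rewrite /= qE.
have yz0 : \sum_i y 0 i * (z 0 i)^* = 0.
  rewrite -unitary_dot //; move/(congr1 toC): xw0.
  by rewrite -[x in LHS]mulmx1 real_form_complexE map_mx1 mulmx1 rmorph0.
have d_ge0 i : 0 <= d 0 i.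
  apply: psd_eigenvalue_ge0; rewrite charS /root horner_prod.
  by rewrite (bigD1 i) //= !hornerE subrr mul0r.
(* In eigencoordinates [w *m S = 0] reads [z *m diag_mx d = 0]: [w] has components only along the
   eigenvalue 0. *)
have zd0 i : z 0 i * toC (d 0 i) = 0.
  move/(congr1 (map_mx toC)): wS0; rewrite map_mxM eqS map_mx0 !mulmxA.
  move/(congr1 (mulmxr (P^t*))) => /=; rewrite mulmxtVK // mul0mx -/z.
  by move/matrixP/(_ 0 i); rewrite mul_mx_diag !mxE.
have [i0 zi0] : exists i0, z 0 i0 != 0.
  apply/rV0Pn; apply: contra_neq w_neq0 => z0.
  apply: (@map_mx_inj _ _ toC); rewrite map_mx0.
  by rewrite -[LHS](mulmxKtV _ uP erefl) -/z z0 mul0mx.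
have di0 : d 0 i0 = 0.
  apply: (@complexI R); apply/eqP; move/eqP: (zd0 i0).
  by rewrite mulf_eq0 (negPf zi0).
have bounds i : i != i0 -> lmin <= d 0 i <= lmax.
  move=> ii0; set l := [seq d 0 i | i <- enum 'I_m].
  have sorted_l : sorted <=%R (sort <=%R l) by apply: sort_sorted; apply: le_total.
  apply: (spectrumS sorted_l).
    rewrite charS (perm_big l) ?perm_sort // big_map.
    by rewrite big_enum.
  apply: (@min_spectrum_perm _ _ (fun i => d 0 i) i0); rewrite ?perm_sort //.
  by move=> j; rewrite di0.
(* If 0 is a multiple eigenvalue it lies in [lmin, lmax]; if it is simple, w
   spans its eigenspace and x has no component along it. *)
have key i : q i = 0 \/ lmin <= d 0 i <= lmax.
  have [->|/bounds] := eqVneq i i0; last by right.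
  have [/existsP[j /andP[ji0 /eqP dj0]]|/existsPn no_j] :=
      boolP [exists j, (j != i0) && (d 0 j == 0)].
    by right; rewrite di0 -dj0 bounds.
  left; apply: (@complexI R); rewrite qE; move: yz0.
  rewrite (bigD1 i0) //= big1 ?addr0 => [|j ji0].
    by move/eqP; rewrite mulf_eq0 conjC_eq0 (negPf zi0) orbF => /eqP ->; rewrite mul0r.
  have := no_j j; rewrite ji0 /= => dj0.
  move/eqP: (zd0 j); rewrite mulf_eq0 => /orP[/eqP->|].
    by rewrite conjC0 mulr0.
  by rewrite (_ : 0 = toC 0) // (inj_eq (@complexI R)) (negPf dj0).
rewrite formE normE !mulr_sumr; apply/andP; split; apply: ler_sum => i _.
  by have [->|/andP[le_d _]] := key i; rewrite ?mulr0 // ler_wpM2r.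
by have [->|/andP[_ le_d]] := key i; rewrite ?mulr0 // ler_wpM2r.
Qed.

End SymmetricRayleigh.

End Spectral.

(** * Normalized Laplacians of weighted graphs *)

Section WeightedGraph.
Variables (R : rcfType) (m : nat) (W : 'M[R]_m) (lmin lmax : R).
Hypothesis symW : W^T = W.
Hypothesis W_ge0 : forall i j, 0 <= W i j.
Let D i := \sum_j W i j.
Hypothesis D_gt0 : forall i, 0 < D i.
Let M := \matrix_(i, j) ((i == j)%:R - W i j / D i).
Hypothesis spectrumM : forall s : seq R, sorted <=%R s ->
  char_poly M = \prod_(x <- s) ('X - x%:P) ->
  forall x, x \in behead s -> lmin <= x <= lmax.

Let r i : R := Num.sqrt (D i).
(** The symmetric normalization [I - D^(-1/2) W D^(-1/2)], whereas [M] is [I - D^(-1) W]. *)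
Let S := \matrix_(i, j) ((i == j)%:R - W i j / (r i * r j)).

Let W_sym i j : W i j = W j i.
Proof. by rewrite -[in LHS]symW mxE. Qed.

Let r_neq0 i : r i != 0.
Proof. by rewrite gt_eqF // sqrtr_gt0. Qed.

Let r_sqr i : r i * r i = D i.
Proof. by rewrite -expr2 sqr_sqrtr ?ltW. Qed.

Let dirichlet (g : 'I_m -> R) :=
  \sum_i D i * g i ^+ 2 - \sum_i \sum_j W i j * g i * g j.

(** Twice the form is the sum of [W i j * (g i - g j) ^+ 2]: by symmetry of [W], the diagonal part
    can be charged to either endpoint. *)
Lemma dirichlet_ge0 g : 0 <= dirichlet g.
Proof.
suff : 0 <= dirichlet g *+ 2 by rewrite pmulrn_lge0.
have <- : \sum_i \sum_j W i j * (g i - g j) ^+ 2 = dirichlet g *+ 2.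
  have DgE : \sum_i D i * g i ^+ 2 = \sum_i \sum_j W i j * g i ^+ 2.
    by apply: eq_bigr => i _; rewrite mulr_suml.
  have DgE' : \sum_i D i * g i ^+ 2 = \sum_i \sum_j W i j * g j ^+ 2.
    rewrite DgE exchange_big; apply: eq_bigr => i _; apply: eq_bigr => j _.
    by rewrite W_sym.
  rewrite mulr2n /dirichlet {1}DgE DgE' addrACA -opprD -!big_split -sumrB /=.
  apply: eq_bigr => i _; rewrite -!big_split -sumrB /=.
  by apply: eq_bigr => j _; ring.
by apply: sumr_ge0 => i _; apply: sumr_ge0 => j _; rewrite mulr_ge0 ?sqr_ge0.
Qed.

Lemma normalized_form (g : 'I_m -> R) (x := \row_i (r i * g i)) :
  (x *m S *m x^T) 0 0 = dirichlet g.
Proof.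
rewrite !mxE; under eq_bigr => j _ do rewrite !mxE mulr_suml.
rewrite exchange_big /= /dirichlet -sumrB; apply: eq_bigr => i _.
transitivity (\sum_j ((i == j)%:R * (r i * g i * (r j * g j)) - W i j * g i * g j)).
  by apply: eq_bigr => j _; rewrite !mxE; field; rewrite !r_neq0.
rewrite sumrB (bigD1 i) //= eqxx big1 ?addr0 => [|j]; last first.
  by rewrite eq_sym => /negPf ->; rewrite mul0r.
by rewrite mul1r -(r_sqr i); congr (_ - _); ring.
Qed.

(** The substitution [x = D^(1/2) g] turns the [D]-weighted norm into the standard one and the
    constants into multiples of [w = D^(1/2) 1], which spans a line in the kernel of [S]. The
    hypothesis on [g] thus becomes orthogonality of [x] to [w]. *)
Lemma weighted_laplacian_rayleigh (g : 'I_m -> R) :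
  \sum_i D i * g i = 0 ->
  lmin * \sum_i D i * g i ^+ 2
    <= \sum_i D i * g i ^+ 2 - \sum_i \sum_j W i j * g i * g j
    <= lmax * \sum_i D i * g i ^+ 2.
Proof.
(* Without vertices all sums are empty; otherwise some vertex witnesses that the kernel vector [w]
   is nonzero. *)
move=> g_orth; have [m0|m_gt0] := posnP m.
  have no_i (i : 'I_m) : False.
    by have := leq_ltn_trans (leq0n i) (ltn_ord i); rewrite m0.
  by rewrite !big1 ?mulr0 ?subr0 ?lexx // => i; case: (no_i i).
(* Conjugation by D^(1/2) makes D^-1 W symmetric without changing the spectrum. *)
pose T := diag_mx (\row_i r i).
have T_unit : T \in unitmx.
  rewrite unitmxE det_diag unitfE; apply/prodf_neq0 => i _.
  by rewrite mxE r_neq0.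
have SE : S = T *m M *m invmx T.
  rewrite -[LHS](mulmxK T_unit); congr (_ *m _).
  apply/matrixP => i j; rewrite mul_mx_diag mul_diag_mx !mxE -(r_sqr i).
  have [->|_] := eqVneq i j; rewrite /= ?mulr1n ?mulr0n.
    by field; rewrite !r_neq0.
  by field; rewrite !r_neq0.
have symS : S^T = S.
  by apply/matrixP => i j; rewrite !mxE eq_sym W_sym (mulrC (r i)).
have psdS (x : 'rV[R]_m) : 0 <= (x *m S *m x^T) 0 0.
  pose h i : R := (r i)^-1 * x 0 i.
  have -> : x = \row_i (r i * h i).
    by apply/rowP => i; rewrite mxE /h mulrA divff ?mul1r.
  by rewrite normalized_form dirichlet_ge0.
pose w := \row_i r i.
(* Column [j] gives [r j - D j / r j], which vanishes since [r j] is a square root of [D j]. *)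
have wS0 : w *m S = 0.
  apply/rowP => j; rewrite !mxE.
  transitivity (\sum_i ((i == j)%:R * r j - W i j / r j)).
    apply: eq_bigr => i _; rewrite !mxE.
    by have [->|_] := eqVneq i j; rewrite /= ?mulr1n ?mulr0n; field; rewrite !r_neq0.
  rewrite sumrB (bigD1 j) //= eqxx mul1r big1 ?addr0; last first.
    by move=> i /negPf ->; rewrite mul0r.
  rewrite -mulr_suml (eq_bigr (W j)) => [|i _]; last by rewrite W_sym.
  by rewrite -/(D j) -r_sqr mulfK ?subrr.
have w_neq0 : w != 0.
  by apply/rV0Pn; exists (Ordinal m_gt0); rewrite mxE.
pose x := \row_i (r i * g i).
have xw0 : (x *m w^T) 0 0 = 0.
  rewrite mxE -[RHS]g_orth; apply: eq_bigr => i _.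
  by rewrite !mxE mulrAC r_sqr.
have xxE : (x *m x^T) 0 0 = \sum_i D i * g i ^+ 2.
  by rewrite mxE; apply: eq_bigr => i _; rewrite !mxE -r_sqr; ring.
have spectrumS s : sorted <=%R s ->
    char_poly S = \prod_(x <- s) ('X - x%:P) ->
    forall x, x \in behead s -> lmin <= x <= lmax.
  by rewrite SE char_poly_conj //; exact: spectrumM.
have := symmetric_rayleigh symS psdS wS0 w_neq0 spectrumS xw0.
by rewrite xxE normalized_form.
Qed.

End WeightedGraph.

(** * Localization to links *)

Section Links.
Variables (R : rcfType) (n : nat) (X : {set {set 'I_n}}).
Hypothesis cplxX : is_complex X.
Implicit Types (F G H : {set 'I_n}) (f g : {set 'I_n} -> R).

(** Adding a vertex to [F] is a bijection, inverted by taking the only vertex of [G :\: F]. The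
    values lie in any [nmodType] so that the lemma serves both sums in [R] and counting in [nat]. *)
Lemma sum_lk_verts (T : nmodType) c F (h : {set 'I_n} -> T) : #|F| = c ->
  \sum_(v in lk_verts X F) h (v |: F)
    = \sum_(G in faces_card X c.+1 | F \subset G) h G.
Proof.
move=> cardF.
have inj : {in lk_verts X F &, injective (fun v => v |: F)}.
  move=> u v; rewrite !inE => /andP[uF _] /andP[vF _] /setP/(_ u).
  by rewrite !inE eqxx (negPf uF) !orbF => /esym/eqP.
rewrite -(big_imset h inj) /=; apply: eq_bigl => G; rewrite !inE.
apply/imsetP/andP => [[v]|[/andP[GX /eqP cardG] FG]].
  rewrite inE => /andP[vF vFX] ->.
  by rewrite vFX cardsU1 vF cardF add1n eqxx subsetU1.
have /cards1P[v Gv] : #|G :\: F| == 1%N.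
  by rewrite cardsD (setIidPr FG) cardG cardF subSnn.
have vG : v \in G :\: F by rewrite Gv set11.
have GE : G = v |: F by rewrite -[LHS](setID G F) (setIidPr FG) setUC Gv.
by exists v => //; move: vG; rewrite !inE -GE GX => /andP[->].
Qed.

(** Downward closure supplies the missing condition that [v] is a vertex of the link: [v |: F] is
    contained in [v |: (u |: F)]. *)
Lemma lk_adj_notin F u v : u \in lk_verts X F ->
  lk_adj X F u v = (v \in lk_verts X (u |: F)).
Proof.
rewrite /lk_adj !inE => /andP[uF uFX]; rewrite uF uFX /= negb_or (eq_sym u v).
rewrite setUCA; case: (boolP (v |: (u |: F) \in X)) => [vuX|]; rewrite ?andbF //.
rewrite !andbT (cplxX vuX) ?andbT 1?andbC //.
by rewrite setUS // subsetU1.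
Qed.

(** Identifies the weights of the link Laplacian with those of [ip]: the neighbours of [u] are the
    vertices extending [u |: F] to a face, counted by [sum_lk_verts] with the constant 1. *)
Lemma lk_degE k F u : #|F| = k.-1 -> (0 < k)%N -> u \in lk_verts X F ->
  lk_deg X F u = deg X k (u |: F).
Proof.
move=> cardF k_gt0 uF.
have card_uF : #|u |: F| = k.
  by move: uF; rewrite inE cardsU1 => /andP[-> _]; rewrite cardF add1n prednK.
rewrite /lk_deg /deg -!sum1_card.
rewrite (eq_bigl (mem (lk_verts X (u |: F)))); last first.
  by move=> v; rewrite inE lk_adj_notin.
rewrite (@sum_lk_verts nat k (u |: F) (fun=> 1%N)) //.
by apply: eq_bigl => H; rewrite !inE andbA.
Qed.

Lemma deg_gt0 k F : pure_dim X k -> F \in X -> (0 < deg X k F)%N.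
Proof.
move=> [_ pureX] /pureX[H HX /andP[cardH FH]].
by apply/card_gt0P; exists H; rewrite inE HX cardH.
Qed.

Lemma incid_sqr G F : F \subset G -> #|G| = #|F|.+1 ->
  incid R G F ^+ 2 = 1.
Proof.
move=> FG cardG; rewrite /incid FG cardG eqxx /=.
case: pickP => [v _|none]; first by rewrite -signr_odd sqrr_sign.
have : #|G :\: F| = 0%N by apply: eq_card0 => v; exact: none.
by rewrite cardsD (setIidPr FG) cardG subSnn.
Qed.

Lemma incid_eq0 G F : ~~ (F \subset G) -> incid R G F = 0.
Proof. by rewrite /incid => /negPf ->. Qed.

Lemma card_facets k G : (0 < k)%N -> G \in faces_card X k ->
  #|[set F in faces_card X k.-1 | F \subset G]| = k.
Proof.
move=> k_gt0; rewrite inE => /andP[GX /eqP cardG].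
rewrite (_ : [set _ in _ | _] = [set F : {set 'I_n} | F \subset G & #|F| == k.-1]).
  by rewrite cards_draws cardG -subn1 bin_sub // bin1.
apply/setP => F; rewrite !inE.
by have [FG|] := boolP (F \subset G); rewrite ?andbF // (cplxX GX FG) andbT.
Qed.

(** * Link forms and their sums over the faces of cardinality [k.-1] *)

Section LinkForms.
Variable k : nat.
Hypotheses (k_gt0 : (0 < k)%N) (pureX : pure_dim X k).

Definition link_fun f F v : R := incid R (v |: F) F * f (v |: F).

Lemma cobound_delta F G : F \in faces_card X k.-1 ->
  cobound X k (fun H => (H == F)%:R) G = incid R G F.
Proof.
move=> FX; rewrite /cobound (bigD1 F) //= eqxx mulr1 big1 ?addr0 // => H.
by case/andP=> _ /negPf ->; rewrite mulr0.
Qed.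

(** The incidence number vanishes on faces that do not contain [F], so the range of summation can be
    made independent of [F]; this is what later permits exchanging the sums. *)
Lemma sum_link_verts (h : {set 'I_n} -> R) F : F \in faces_card X k.-1 ->
  \sum_(v in lk_verts X F) incid R (v |: F) F * h (v |: F)
    = \sum_(G in faces_card X k) incid R G F * h G.
Proof.
rewrite inE => /andP[_ /eqP cardF].
rewrite (sum_lk_verts (fun G => incid R G F * h G) cardF) prednK //.
rewrite [RHS](bigID (fun G => F \subset G)) /= [X in _ + X]big1 ?addr0 // => G.
by case/andP=> _ /incid_eq0 ->; rewrite mul0r.
Qed.

Lemma link_fun_orth f F : orth_B X k f -> F \in faces_card X k.-1 ->
  \sum_(v in lk_verts X F) (lk_deg X F v)%:R * link_fun f F v = 0.
Proof.
move=> f_orth FX; rewrite -[RHS](f_orth (fun H => (H == F)%:R)) /ip.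
transitivity (\sum_(v in lk_verts X F)
   incid R (v |: F) F * ((deg X k (v |: F))%:R * f (v |: F))).
  move: FX; rewrite inE => /andP[_ /eqP cardF].
  by apply: eq_bigr => v vF; rewrite (lk_degE cardF) // /link_fun mulrCA.
rewrite (sum_link_verts (fun G => (deg X k G)%:R * f G)) //.
by apply: eq_bigr => G _; rewrite cobound_delta // mulrC.
Qed.

Definition link_norm f F : R :=
  \sum_(v in lk_verts X F) (lk_deg X F v)%:R * link_fun f F v ^+ 2.

Definition link_adj_form f F : R :=
  \sum_(u in lk_verts X F) \sum_(v in lk_verts X F)
    (lk_adj X F u v)%:R * link_fun f F u * link_fun f F v.

Lemma sum_link_norm f :
  \sum_(F in faces_card X k.-1) link_norm f F = k%:R * ip X k f f.
Proof.
transitivity (\sum_(F in faces_card X k.-1) \sum_(G in faces_card X k)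
   (F \subset G)%:R * ((deg X k G)%:R * f G * f G)).
  apply: eq_bigr => F; rewrite inE => /andP[_ /eqP cardF].
  transitivity (\sum_(v in lk_verts X F)
      (deg X k (v |: F))%:R * f (v |: F) * f (v |: F)).
    apply: eq_bigr => v vF; rewrite (lk_degE cardF) // /link_fun exprMn.
    rewrite incid_sqr ?subsetU1 ?mul1r ?expr2 ?mulrA //.
    by move: vF; rewrite inE cardsU1 => /andP[-> _].
  rewrite (sum_lk_verts (fun G => (deg X k G)%:R * f G * f G) cardF) prednK //.
  rewrite big_mkcondr; apply: eq_bigr => G _.
  by case: (F \subset G); rewrite ?mul1r ?mul0r.
(* After the exchange, [G] is counted once for each of its [k] facets. *)
rewrite exchange_big /= mulr_sumr; apply: eq_bigr => G GX.
rewrite -mulr_suml; congr (_ * _).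
rewrite -natr_sum -[in RHS](card_facets k_gt0 GX) -sum1_card; congr _%:R.
rewrite [RHS](eq_bigl (fun F => (F \in faces_card X k.-1) && (F \subset G))).
  by rewrite big_mkcondr; apply: eq_bigr => F _; case: (F \subset G).
by move=> F; rewrite !inE.
Qed.

(** A common facet of distinct [G] and [H] has [k.-1] vertices and lies in [G :&: H], which has at
    most [k.-1]; hence only [F = G :&: H] can contribute. *)
Lemma sum_incid_pair G H : G \in faces_card X k -> H \in faces_card X k ->
  \sum_(F in faces_card X k.-1)
     ((G != H) && (G :|: H \in X))%:R * incid R G F * incid R H F
  = Aup R X k G H.
Proof.
rewrite !inE /Aup => /andP[GX /eqP cardG] /andP[HX /eqP cardH].
have [GHX|_] := boolP (G :|: H \in X); last first.
  by rewrite !andbF big1 // => F _; rewrite !mul0r.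
have [<-|neqGH] /= := eqVneq G H.
  (* The diagonal of [Aup] is zero: [G] meets itself in [k] vertices, and [k] differs from [k.-1] as
     [k] is positive. *)
  rewrite setIid cardG big1 => [|F _]; last by rewrite !mul0r.
  by case: (k) k_gt0 => // j _; rewrite gtn_eqF.
have cardI : (#|G :&: H| <= k.-1)%N.
  rewrite -ltnS prednK // -cardG; apply: proper_card.
  rewrite properEneq subsetIl andbT; apply: contra_neq neqGH => /setIidPl GH.
  by apply/eqP; rewrite eqEcard GH cardG cardH /=.
have cap_only F : F \in faces_card X k.-1 -> F != G :&: H ->
    1 * incid R G F * incid R H F = 0.
  rewrite inE => /andP[_ /eqP cardF] FGH.
  have : ~~ (F \subset G :&: H).
    by apply: contra FGH => FGH; rewrite eqEcard FGH cardF.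
  rewrite subsetI negb_and => /orP[/incid_eq0 ->|/incid_eq0 ->].
    by rewrite mulr0 mul0r.
  by rewrite mulr0.
rewrite andbT; case: eqP => [cardGH|ncard].
  have IX : G :&: H \in faces_card X k.-1.
    by rewrite inE (cplxX GX) ?subsetIl // cardGH eqxx.
  rewrite (bigD1 (G :&: H)) //= mul1r big1 ?addr0 // => F /andP[FX FGH].
  exact: cap_only.
(* Here [G :&: H] has the wrong cardinality to be an index of the sum, so no term survives. *)
apply: big1 => F FX; apply: cap_only => //.
by apply/eqP => FE; move: FX; rewrite inE FE => /andP[_ /eqP].
Qed.

(** Adjacency is expressed through the two faces alone, so [F] enters the link forms only through
    incidence numbers. The symmetry in [u] and [v] also becomes visible. *)
Lemma lk_adjE F u v : u \in lk_verts X F -> v \in lk_verts X F ->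
  lk_adj X F u v
    = (u |: F != v |: F) && ((u |: F) :|: (v |: F) \in X).
Proof.
move=> uF vF; rewrite /lk_adj uF vF /= setUACA setUid -setUA; congr (~~ _ && _).
apply/eqP/eqP => [-> //|/setP/(_ u)]; move: uF; rewrite !inE eqxx.
by case/andP=> /negPf -> _; rewrite !orbF => /esym/eqP.
Qed.

Lemma sum_link_adj_form f :
  \sum_(F in faces_card X k.-1) link_adj_form f F
  = \sum_(G in faces_card X k) \sum_(H in faces_card X k)
      Aup R X k G H * f G * f H.
Proof.
pose c G H : R := ((G != H) && (G :|: H \in X))%:R.
transitivity (\sum_(F in faces_card X k.-1) \sum_(G in faces_card X k)
   \sum_(H in faces_card X k) c G H * incid R G F * incid R H F * f G * f H).
  apply: eq_bigr => F FX.
  (* Each summand is regrouped as an incidence number times a function of the face, the shape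
     required by [sum_link_verts], which then converts the inner sum and afterwards the outer
     one. *)
  transitivity (\sum_(u in lk_verts X F) incid R (u |: F) F *
     (f (u |: F) * \sum_(v in lk_verts X F)
        incid R (v |: F) F * (c (u |: F) (v |: F) * f (v |: F)))).
    apply: eq_bigr => u uF; rewrite !mulr_sumr; apply: eq_bigr => v vF.
    by rewrite lk_adjE // /link_fun /c; ring.
  transitivity (\sum_(u in lk_verts X F) incid R (u |: F) F *
     (f (u |: F) * \sum_(H in faces_card X k)
        incid R H F * (c (u |: F) H * f H))).
    apply: eq_bigr => u uF.
    by rewrite (sum_link_verts (fun H => c (u |: F) H * f H)).
  rewrite (sum_link_verts (fun G => f G * \sum_(H in faces_card X k)
        incid R H F * (c G H * f H))) //.
  apply: eq_bigr => G _; rewrite !mulr_sumr; apply: eq_bigr => H _; ring.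
rewrite exchange_big; apply: eq_bigr => G GX /=.
rewrite exchange_big; apply: eq_bigr => H HX /=.
by rewrite -!mulr_suml sum_incid_pair.
Qed.

(** The weight [deg X k G] of [ip] cancels the inverse degree in [Lup]; purity guarantees that this
    degree is nonzero. *)
Lemma ip_Lup f :
  ip X k (Lup X k f) f = ip X k f f
    - \sum_(G in faces_card X k) \sum_(H in faces_card X k)
        Aup R X k G H * f G * f H.
Proof.
rewrite /ip -sumrB; apply: eq_bigr => G; rewrite inE => /andP[GX _].
have deg_neq0 : (deg X k G)%:R != 0 :> R.
  by rewrite pnatr_eq0 -lt0n deg_gt0.
rewrite /Lup mulrBr mulVKf // mulrBl; congr (_ - _).
by rewrite mulr_suml; apply: eq_bigr => H _; rewrite mulrAC.
Qed.

Lemma lk_degE_sum F u : u \in lk_verts X F ->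
  (lk_deg X F u)%:R = \sum_(v in lk_verts X F) (lk_adj X F u v)%:R :> R.
Proof.
move=> uF; rewrite -natr_sum /lk_deg -sum1_card big_mkcond [in RHS]big_mkcond /=.
congr _%:R; apply: eq_bigr => v _; rewrite inE.
by case: (boolP (lk_adj X F u v)) => [/and4P[_ ->]|_]; rewrite ?if_same.
Qed.

(** The link is a weighted graph with 0-1 weights once its vertices are numbered by [enum_val]. Its
    row sums are positive because purity puts each [u |: F] into a face of cardinality [k.+1]. *)
Lemma link_rayleigh f F (lmin lmax : R) :
  F \in faces_card X k.-1 -> orth_B X k f ->
  (forall s : seq R, sorted <=%R s ->
     char_poly (lk_laplacian R X F) = \prod_(x <- s) ('X - x%:P) ->
     forall x, x \in behead s -> lmin <= x <= lmax) ->
  lmin * link_norm f F <= link_norm f F - link_adj_form f F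
    <= lmax * link_norm f F.
Proof.
move=> FX f_orth spectrum; set A := lk_verts X F.
have cardF : #|F| = k.-1 by move: FX; rewrite inE => /andP[_ /eqP].
pose W : 'M[R]_#|A| := \matrix_(i, j) (lk_adj X F (enum_val i) (enum_val j))%:R.
pose g (i : 'I_#|A|) := link_fun f F (enum_val i).
have degE i : \sum_j W i j = (lk_deg X F (enum_val i))%:R.
  rewrite lk_degE_sum ?enum_valP // [RHS]big_enum_val /=.
  by apply: eq_bigr => j _; rewrite mxE.
have symW : W^T = W.
  apply/matrixP => i j; rewrite !mxE !lk_adjE ?enum_valP //.
  by rewrite eq_sym; congr (_ && (_ \in X))%:R; exact: setUC.
have W_ge0 i j : 0 <= W i j by rewrite mxE ler0n.
have deg_gt0 i : 0 < \sum_j W i j.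
  rewrite degE ltr0n (lk_degE cardF) ?enum_valP // deg_gt0 //.
  by have := enum_valP i; rewrite inE => /andP[].
have laplE : lk_laplacian R X F
    = \matrix_(i, j) ((i == j)%:R - W i j / \sum_l W i l).
  by apply/matrixP => i j; rewrite !mxE degE.
rewrite laplE in spectrum.
have normE : link_norm f F = \sum_i (\sum_j W i j) * g i ^+ 2.
  by rewrite /link_norm big_enum_val; apply: eq_bigr => i _; rewrite degE.
have formE : link_adj_form f F = \sum_i \sum_j W i j * g i * g j.
  rewrite /link_adj_form big_enum_val; apply: eq_bigr => i _.
  by rewrite big_enum_val; apply: eq_bigr => j _; rewrite mxE.
rewrite normE formE; apply: weighted_laplacian_rayleigh => //.
rewrite -[RHS](link_fun_orth f_orth FX) [RHS]big_enum_val.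
by apply: eq_bigr => i _; rewrite degE.
Qed.

Lemma ip_Lup_bounds f (lmin lmax : R) :
  (forall F, F \in faces_card X k.-1 ->
     forall s : seq R, sorted <=%R s ->
       char_poly (lk_laplacian R X F) = \prod_(x <- s) ('X - x%:P) ->
       forall x, x \in behead s -> lmin <= x <= lmax) ->
  orth_B X k f ->
  (1 + k%:R * lmin - k%:R) * ip X k f f <= ip X k (Lup X k f) f
     <= (1 + k%:R * lmax - k%:R) * ip X k f f.
Proof.
move=> spectrum f_orth.
have LupE : ip X k (Lup X k f) f = ip X k f f - k%:R * ip X k f f
    + \sum_(F in faces_card X k.-1) (link_norm f F - link_adj_form f F).
  by rewrite ip_Lup sumrB sum_link_norm sum_link_adj_form; ring.
have lower : lmin * (k%:R * ip X k f f)
    <= \sum_(F in faces_card X k.-1) (link_norm f F - link_adj_form f F).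
  rewrite -sum_link_norm mulr_sumr; apply: ler_sum => F FX.
  by case/andP: (link_rayleigh FX f_orth (spectrum F FX)).
have upper : \sum_(F in faces_card X k.-1) (link_norm f F - link_adj_form f F)
    <= lmax * (k%:R * ip X k f f).
  rewrite -sum_link_norm mulr_sumr; apply: ler_sum => F FX.
  by case/andP: (link_rayleigh FX f_orth (spectrum F FX)).
rewrite LupE; apply/andP; split.
  rewrite (_ : _ * ip X k f f = ip X k f f - k%:R * ip X k f f
             + lmin * (k%:R * ip X k f f)); last by ring.
  by rewrite lerD2l.
rewrite (_ : (1 + _ - _) * ip X k f f = ip X k f f - k%:R * ip X k f f
           + lmax * (k%:R * ip X k f f)); last by ring.
by rewrite lerD2l.
Qed.

(** Cochains are functions on all vertex sets, so being nonzero has to be witnessed on a face over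
    which [ip] sums; purity makes the weight of that face positive. *)
Lemma ip_gt0 f : (exists2 F, F \in faces_card X k & f F != 0) ->
  0 < ip X k f f.
Proof.
move=> [F FX fF]; rewrite /ip (bigD1 F) //= ltr_wpDr //.
  by apply: sumr_ge0 => G _; rewrite -mulrA mulr_ge0 ?ler0n // -expr2 sqr_ge0.
rewrite -mulrA mulr_gt0 // ?ltr0n; last by rewrite -expr2 exprn_even_gt0.
by move: FX; rewrite inE => /andP[/(deg_gt0 pureX)].
Qed.

End LinkForms.

End Links.

Theorem theorem3p1 (R : rcfType) (n : nat) (X : {set {set 'I_n}}) (k : nat)
  (lmin lmax : R) :
  (0 < k)%N -> is_complex X -> pure_dim X k ->
  (forall F, F \in faces_card X k.-1 ->
     forall s : seq R, sorted <=%R s ->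
       char_poly (lk_laplacian R X F) = \prod_(x <- s) ('X - x%:P) ->
       forall x, x \in behead s -> lmin <= x <= lmax) ->
  (forall f : {set 'I_n} -> R, orth_B X k f ->
     (1 + k%:R * lmin - k%:R) * ip X k f f <= ip X k (Lup X k f) f
     <= (1 + k%:R * lmax - k%:R) * ip X k f f)
  /\
  (forall (f : {set 'I_n} -> R) (mu : R), orth_B X k f ->
     (exists2 F, F \in faces_card X k & f F != 0) ->
     (forall F, F \in faces_card X k -> Lup X k f F = mu * f F) ->
     1 + k%:R * lmin - k%:R <= mu <= 1 + k%:R * lmax - k%:R).
Proof.
move=> k_gt0 cplxX pureX spectrum.
have bounds f := @ip_Lup_bounds _ _ _ cplxX _ k_gt0 pureX f _ _ spectrum.
split=> // f mu f_orth f_neq0 eigf.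
have ff_gt0 := ip_gt0 pureX f_neq0.
(* For an eigenfunction the Rayleigh quotient is [mu], and positivity of [ip X k f f] allows
   cancelling it from both bounds. *)
have LupE : ip X k (Lup X k f) f = mu * ip X k f f.
  rewrite /ip mulr_sumr; apply: eq_bigr => F FX.
  by rewrite eigf //; ring.
by have := bounds f f_orth; rewrite LupE !ler_pM2r.
Qed.
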